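(* Let $X$ be a real random variable with finite fourth moment and $\mathbb{E}(X)=0$; write $\mu_2=\mathbb{E}(X^2)$ and $\mu_4=\mathbb{E}(X^4)$. Let $L=(X_1,\dots,X_n)$ be an i.i.d. sample of $X$ with $n\ge 2$. For a sample $(Y_1,\dots,Y_k)$ with $k\ge 2$ let $\hat v(Y_1,\dots,Y_k)=\frac1{k-1}\sum_{i=1}^k\big(Y_i-\frac1k\sum_{j=1}^kY_j\big)^2$ be the unbiased sample variance. Fix a batch size $m\ge 2$ and $N\ge1$. Let $\mathcal U$ be the set of all functions $u:\{1,\dots,m\}\to\{1,\dots,n\}$, $L_u=(X_{u(1)},\dots,X_{u(m)})$, let $B=(U^1,\dots,U^N)$ be i.i.d. uniform on $\mathcal U$ and independent of $L$, and let $\tilde v(L,B)=\frac1N\sum_{i=1}^N\hat v(L_{U^i})$. Let $U$ be uniform on $\mathcal U$ independent of $L$, with $\mathbb{E}_U,\mathrm{Var}_U$ the conditional expectation/variance over $U$ given $L$. Then: (1) $\mathbb{E}_{(L,B)}(\tilde v(L,B))=\frac{n-1}{n}\mu_2$; (2) $\mathrm{Var}_{(L,B)}(\tilde v(L,B))=\frac1N\mathbb{E}_L\big(\mathrm{Var}_U(\hat v(L_U))\big)+\mathrm{Var}_L\big(\mathbb{E}_U(\hat v(L_U))\big)$, where $$\mathbb{E}_L\big(\mathrm{Var}_U(\hat v(L_U))\big)=\frac{n-1}{nm(m-1)}\Big(3m-3+\frac{n^2-2n+3}{n^2}(6-4m)\Big)\mu_2^2+\frac{n-1}{nm(m-1)}\Big(m-1+\frac{n-1}{n^2}(6-4m)\Big)\mu_4$$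 and $$\mathrm{Var}_L\big(\mathbb{E}_U(\hat v(L_U))\big)=\frac{(3-n)(n-1)}{n^3}\mu_2^2+\frac{(n-1)^2}{n^3}\mu_4.$$ Moreover $\mathrm{MSE}(\tilde v(L,B)):=\mathbb{E}_{(L,B)}\big((\tilde v(L,B)-\mu_2)^2\big)=\mathrm{Var}_{(L,B)}(\tilde v(L,B))+\frac1{n^2}\mu_2^2$.
   Context: $\mathbb{E}_L,\mathrm{Var}_L$ are taken with respect to the sample $L$; $\mathbb{E}_{(L,B)},\mathrm{Var}_{(L,B)}$ with respect to the pair $(L,B)$. $\tilde v$ is the bagged unbiased sample variance estimator with batch size $m$ and $N$ bagging iterations. *)

(* Defs.v *)
From HB Require Import structures.
From mathcomp Require Import all_boot all_order all_algebra.
From mathcomp Require Import all_classical all_reals all_analysis.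
Set Implicit Arguments. Unset Strict Implicit. Unset Printing Implicit Defensive.
Import Order.TTheory GRing.Theory Num.Theory.
Local Open Scope classical_set_scope.
Local Open Scope ring_scope.

Definition vhat (R : realType) (k : nat) (y : 'I_k -> R) : R :=
  (k.-1)%:R^-1 * \sum_(i < k) (y i - k%:R^-1 * \sum_(j < k) y j) ^+ 2.

Definition Lsub (R : realType) (n m : nat) (x : 'I_n -> R)
  (u : {ffun 'I_m -> 'I_n}) : 'I_m -> R := fun j => x (u j).

Definition EU (R : realType) (n m : nat) (x : 'I_n -> R) : R :=
  (#|{ffun 'I_m -> 'I_n}|%:R)^-1 *
    \sum_(u : {ffun 'I_m -> 'I_n}) vhat (Lsub x u).

Definition VarU (R : realType) (n m : nat) (x : 'I_n -> R) : R :=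
  (#|{ffun 'I_m -> 'I_n}|%:R)^-1 *
    \sum_(u : {ffun 'I_m -> 'I_n}) (vhat (Lsub x u) - EU m x) ^+ 2.

Definition vtilde (d : measure_display) (T : measurableType d) (R : realType)
  (n m N : nat) (Xs : 'I_n -> T -> R) (Us : 'I_N -> T -> {ffun 'I_m -> 'I_n})
  (w : T) : R :=
  N%:R^-1 * \sum_(k < N) vhat (Lsub (fun i => Xs i w) (Us k w)).

(* mutual independence of X_0..X_{n-1}, U^0..U^{N-1}: product rule for
   events (taking setT for unconstrained coordinates gives all subfamilies) *)
Definition mutually_independent (d : measure_display) (T : measurableType d)
  (R : realType) (P : probability T R) (n N : nat) (V : Type)
  (Xs : 'I_n -> T -> R) (Us : 'I_N -> T -> V) : Prop :=
  forall (A : 'I_n -> set R) (S : 'I_N -> set V),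
    (forall i, measurable (A i)) ->
    P ((\bigcap_(i in [set: 'I_n]) (Xs i @^-1` A i)) `&`
       (\bigcap_(k in [set: 'I_N]) (Us k @^-1` S k))) =
    ((\prod_(i < n) P (Xs i @^-1` A i)) * (\prod_(k < N) P (Us k @^-1` S k)))%E.

(* Main.v *)
(* An average over samples from a finite population is the expectation over an
   i.i.d. family, so the sample L, the bootstrap draw u and the bag (U^1..U^N)
   are all instances of one situation: a linear functional on polynomials of
   degree at most 4 that evaluates monomials as products of moments. For centred
   moments such a functional maps x_i x_j x_k x_l to mu_2^2 times the sum of the
   three pairings plus the excess mu_4 - 3 mu_2^2 on the diagonal, which gives
   E(vhat) = mu_2 and E(vhat^2) = mu_2^2 + 2 mu_2^2 / (k-1) + (mu_4 - 3 mu_2^2) / k.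
   Applied to the draw, with the empirical moments of the centred data, this
   expresses E_U and Var_U through the second and fourth empirical moments; those
   are polynomials in L, to which the same rule applies. Applied to the bag, it
   gives the average of vtilde^2 over the bag as E_U^2 + Var_U / N. *)
Require Import Defs.
From HB Require Import structures.
From mathcomp Require Import all_boot all_order all_algebra.
From mathcomp Require Import all_classical all_reals all_analysis.
From mathcomp Require Import finmap measurable_realfun simple_functions ring.
Set Implicit Arguments.
Unset Strict Implicit.
Unset Printing Implicit Defensive.
Import Order.TTheory GRing.Theory Num.Theory numFieldNormedType.Exports.
Local Open Scope classical_set_scope.
Local Open Scope ring_scope.

(* [E] computes expectations as if the coordinates were i.i.d. with raw moments
   [mu]; degree 4 is all that a variance of [vhat] needs. *)
Definition iid_moments (R : realType) (k : nat)
    (E : (('I_k -> R) -> R) -> R) (mu : nat -> R) : Prop :=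
  forall (I : finType) (c : I -> R) (s : I -> seq 'I_k),
    (forall i, (size (s i) <= 4)%N) ->
  E (fun x => \sum_i c i * \prod_(j <- s i) x j) =
  \sum_i c i * \prod_(j < k) mu (count_mem j (s i)).

(** * Mixed moments of centred i.i.d. variables in degrees two and four *)

Lemma prod_count_undup (R : comPzRingType) (I : finType) (mu : nat -> R)
    (s : seq I) : mu 0%N = 1 ->
  \prod_i mu (count_mem i s) = \prod_(i <- undup s) mu (count_mem i s).
Proof.
move=> mu0; rewrite (bigID (mem s)) /= [X in _ * X]big1 ?mulr1; last first.
  by move=> i /count_memPn ->.
rewrite [RHS]big_uniq ?undup_uniq//=; apply: eq_bigl => i.
by rewrite mem_undup.
Qed.

Lemma prod_count2 (R : comPzRingType) (I : finType) (mu : nat -> R) (a b : I) :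
  mu 0%N = 1 -> mu 1%N = 0 ->
  \prod_i mu (count_mem i [:: a; b]) = mu 2%N * (a == b)%:R.
Proof.
move=> mu0 mu1; rewrite prod_count_undup//= inE.
have [->|ab] := eqVneq a b; rewrite ?big_seq1 ?big_cons ?big_nil /= ?eqxx ?mulr1//.
by rewrite (negbTE ab) eq_sym (negbTE ab) /= mu1 mul0r mulr0.
Qed.

(** As [mu 1 = 0], an index occurring exactly once kills the product, which leaves two disjoint
    pairs or four equal indices. In the latter case all three pairings are present and contribute
    [3 * mu 2 ^+ 2], so only the excess remains to be added. *)
Lemma prod_count4 (R : comPzRingType) (I : finType) (mu : nat -> R)
    (a b c e : I) : mu 0%N = 1 -> mu 1%N = 0 ->
  \prod_i mu (count_mem i [:: a; b; c; e]) =
  mu 2%N ^+ 2 * ((a == b)%:R * (c == e)%:R + (a == c)%:R * (b == e)%:R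
                 + (a == e)%:R * (b == c)%:R)
  + (mu 4%N - 3 * mu 2%N ^+ 2) * ((a == b)%:R * (a == c)%:R * (a == e)%:R).
Proof.
move=> mu0 mu1; rewrite prod_count_undup//= !inE.
(* one case for each equality pattern of a, b, c, e *)
repeat (match goal with |- context [?x == ?y] =>
  let H := fresh in have [H|H] := eqVneq x y;
   [subst x|rewrite ?(eq_sym y x) ?(negbTE H)] end;
  repeat (match goal with H : is_true (?x != ?y) |- _ =>
    rewrite ?(eq_sym y x) ?(negbTE H) /=; revert H end);
  intros; rewrite ?eqxx /=).
all: rewrite ?big_cons ?big_nil ?eqxx /=.
all: repeat (match goal with H : is_true (?x != ?y) |- _ =>
  rewrite ?(eq_sym y x) ?(negbTE H) /=; clear H end).
all: rewrite ?addn0 ?addn1 ?mu0 ?mu1.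
all: ring.
Qed.

Lemma sum_pair4 (R : pzRingType) (I : finType) (F : I -> I -> I -> I -> R) :
  \sum_(p : (I * I) * (I * I)) F p.1.1 p.1.2 p.2.1 p.2.2 =
  \sum_i \sum_j \sum_k \sum_l F i j k l.
Proof.
rewrite -(pair_bigA _ (fun p q => F p.1 p.2 q.1 q.2))/=.
rewrite -(pair_bigA _ (fun i j => \sum_q F i j q.1 q.2))/=.
apply: eq_bigr => i _; apply: eq_bigr => j _.
by rewrite -(pair_bigA _ (F i j)).
Qed.

Lemma sum_delta (R : pzRingType) (I : finType) (a : I) (F : I -> R) :
  \sum_i (a == i)%:R * F i = F a.
Proof.
rewrite (bigD1 a)//= eqxx mul1r big1 ?addr0// => i ia.
by rewrite eq_sym (negbTE ia) mul0r.
Qed.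

(** * Moments of quadratic forms and of powers of linear forms *)

Section iid_moments.
Variables (R : realType) (k : nat) (E : (('I_k -> R) -> R) -> R).
Variable mu : nat -> R.
Hypotheses (Emu : iid_moments E mu) (mu0 : mu 0%N = 1) (mu1 : mu 1%N = 0).

Lemma moment_quadratic (A : 'I_k -> 'I_k -> R) :
  E (fun x => \sum_i \sum_j A i j * (x i * x j)) = mu 2%N * \sum_i A i i.
Proof.
have := @Emu _ (fun p : 'I_k * 'I_k => A p.1 p.2)
            (fun p => [:: p.1; p.2]) (fun=> isT).
rewrite -(pair_bigA _ (fun i j => A i j * \prod_j0 mu (count_mem j0 [:: i; j]))) /=.
under eq_fun => x.
  under eq_bigr do rewrite 2!big_cons big_nil mulr1.
  rewrite -(pair_bigA _ (fun i j => A i j * (x i * x j))) /=.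
  over.
move=> ->; rewrite mulr_sumr; apply: eq_bigr => i _.
under eq_bigr do rewrite prod_count2// mulrCA [A _ _ * _]mulrC.
by rewrite -mulr_sumr sum_delta.
Qed.

Lemma moment_quartic (C : 'I_k -> 'I_k -> 'I_k -> 'I_k -> R) :
  E (fun x => \sum_i \sum_j \sum_a \sum_b
                C i j a b * (x i * x j * (x a * x b))) =
  mu 2%N ^+ 2 * (\sum_i \sum_j (C i i j j + C i j i j + C i j j i))
  + (mu 4%N - 3 * mu 2%N ^+ 2) * \sum_i C i i i i.
Proof.
have := @Emu _ (fun p : ('I_k * 'I_k) * ('I_k * 'I_k) => C p.1.1 p.1.2 p.2.1 p.2.2)
            (fun p => [:: p.1.1; p.1.2; p.2.1; p.2.2]) (fun=> isT).
rewrite (sum_pair4 (fun i j a b =>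
  C i j a b * \prod_j0 mu (count_mem j0 [:: i; j; a; b]))) /=.
under eq_fun => x.
  under eq_bigr => p _ do rewrite 4!big_cons big_nil mulr1 (mulrA (x p.1.1)).
  rewrite (sum_pair4 (fun i j a b => C i j a b * (x i * x j * (x a * x b)))) /=.
  over.
move=> ->; rewrite !mulr_sumr -big_split/=; apply: eq_bigr => i _.
pose K := mu 4%N - 3 * mu 2%N ^+ 2.
(* One sum for each of the three pairings and one for the full diagonal, with the deltas placed so
   that [sum_delta] removes one summation at a time. *)
transitivity (\sum_j (i == j)%:R * (mu 2%N ^+ 2 * \sum_a \sum_b (a == b)%:R * C i j a b)
  + \sum_j \sum_a (i == a)%:R * (mu 2%N ^+ 2 * \sum_b (j == b)%:R * C i j a b)
  + \sum_j \sum_a (j == a)%:R * (mu 2%N ^+ 2 * \sum_b (i == b)%:R * C i j a b)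
  + \sum_j (i == j)%:R * \sum_a (i == a)%:R * \sum_b (i == b)%:R * (K * C i j a b)).
  rewrite -!big_split/=; apply: eq_bigr => j _.
  rewrite !mulr_sumr -!big_split/=; apply: eq_bigr => a _.
  rewrite !mulr_sumr -!big_split/=; apply: eq_bigr => b _.
  rewrite prod_count4// -/K; ring.
rewrite !sum_delta; congr (_ + _).
have -> : \sum_j \sum_a (i == a)%:R * (mu 2%N ^+ 2 * \sum_b (j == b)%:R * C i j a b)
    = mu 2%N ^+ 2 * \sum_j C i j i j.
  by rewrite mulr_sumr; apply: eq_bigr => j _; rewrite !sum_delta.
have -> : \sum_j \sum_a (j == a)%:R * (mu 2%N ^+ 2 * \sum_b (i == b)%:R * C i j a b)
    = mu 2%N ^+ 2 * \sum_j C i j j i.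
  by rewrite mulr_sumr; apply: eq_bigr => j _; rewrite !sum_delta.
rewrite -!mulrDr -!big_split/=; congr (_ * _); apply: eq_bigr => j _.
by rewrite sum_delta.
Qed.

Lemma moment_linear2 (c : 'I_k -> R) :
  E (fun x => (\sum_i c i * x i) ^+ 2) = mu 2%N * \sum_i c i ^+ 2.
Proof.
under [X in _ = _ * X]eq_bigr do rewrite expr2.
rewrite -(moment_quadratic (fun i j => c i * c j)); congr E.
apply/funext => x; rewrite expr2 big_distrlr/=.
by apply: eq_bigr => i _; apply: eq_bigr => j _; rewrite mulrACA.
Qed.

(** Pairing within each copy of the form gives the squared trace; the two pairings across the copies
    coincide by symmetry, hence the factor 2. *)
Lemma moment_quadratic_sqr (A : 'I_k -> 'I_k -> R) :
  (forall i j, A i j = A j i) ->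
  E (fun x => (\sum_i \sum_j A i j * (x i * x j)) ^+ 2) =
  mu 2%N ^+ 2 * ((\sum_i A i i) ^+ 2 + 2 * \sum_i \sum_j A i j ^+ 2)
  + (mu 4%N - 3 * mu 2%N ^+ 2) * \sum_i A i i ^+ 2.
Proof.
move=> symA; transitivity (E (fun x => \sum_i \sum_j \sum_a \sum_b
    (A i j * A a b) * (x i * x j * (x a * x b)))).
  congr E; apply/funext => x; rewrite expr2.
  rewrite big_distrl/=; apply: eq_bigr => i _.
  rewrite big_distrl/=; apply: eq_bigr => j _.
  rewrite big_distrr/=; apply: eq_bigr => a _.
  by rewrite big_distrr/=; apply: eq_bigr => b _; rewrite mulrACA.
rewrite (moment_quartic (fun i j a b => A i j * A a b)); congr (_ * _ + _).
rewrite expr2 big_distrlr/= mulr_sumr -big_split/=; apply: eq_bigr => i _.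
rewrite mulr_sumr -big_split/=; apply: eq_bigr => j _.
by rewrite (symA j i); ring.
Qed.

(** The fourth power is the square of the rank-one form [c i * c j], whose squared trace and squared
    Frobenius norm agree; this gives the factor 1 + 2 = 3. *)
Lemma moment_linear4 (c : 'I_k -> R) :
  E (fun x => (\sum_i c i * x i) ^+ 4) =
  3 * mu 2%N ^+ 2 * (\sum_i c i ^+ 2) ^+ 2
  + (mu 4%N - 3 * mu 2%N ^+ 2) * \sum_i c i ^+ 4.
Proof.
transitivity (E (fun x => (\sum_i \sum_j (c i * c j) * (x i * x j)) ^+ 2)).
  congr E; apply/funext => x; rewrite (exprM _ 2 2); congr (_ ^+ 2).
  rewrite expr2 big_distrlr/=.
  by apply: eq_bigr => i _; apply: eq_bigr => j _; rewrite mulrACA.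
rewrite moment_quadratic_sqr; last by move=> i j; rewrite mulrC.
under [X in X ^+ 2 + _]eq_bigr do rewrite -expr2.
have -> : \sum_i \sum_j (c i * c j) ^+ 2 = (\sum_i c i ^+ 2) ^+ 2.
  rewrite [RHS]expr2 big_distrlr/=.
  by apply: eq_bigr => i _; apply: eq_bigr => j _; rewrite exprMn.
under [X in _ + _ * X = _]eq_bigr do rewrite -expr2 -exprM.
by congr (_ + _); ring.
Qed.

End iid_moments.

(** * The sample variance as a quadratic form, and its first two moments *)

(** The centring projection (identity minus the constant matrix [k^-1]), divided by [k - 1]. *)
Definition vhat_coef (R : realType) (k : nat) (i j : 'I_k) : R :=
  k.-1%:R^-1 * ((i == j)%:R - k%:R^-1).

Lemma sum_cst_ord (R : pzRingType) (k : nat) (c : R) : \sum_(i < k) c = k%:R * c.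
Proof. by rewrite sumr_const card_ord mulr_natl. Qed.

Lemma sum_sqr_center (R : realType) (k : nat) (x : 'I_k -> R) : (0 < k)%N ->
  \sum_i (x i - k%:R^-1 * \sum_j x j) ^+ 2 =
  \sum_i x i ^+ 2 - k%:R^-1 * (\sum_i x i) ^+ 2.
Proof.
move=> k0; set S := \sum_j x j.
under eq_bigr do rewrite sqrrB.
rewrite big_split/= sumrB sum_cst_ord sumrMnl -mulr_suml -/S.
have k0' : k%:R != 0 :> R by rewrite pnatr_eq0 -lt0n.
by field.
Qed.

Lemma vhat_quadratic (R : realType) (k : nat) (x : 'I_k -> R) : (0 < k)%N ->
  vhat x = \sum_i \sum_j vhat_coef R i j * (x i * x j).
Proof.
move=> k0; rewrite /vhat sum_sqr_center// expr2 big_distrlr/=.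
rewrite mulrBr !mulr_sumr -sumrB; apply: eq_bigr => i _.
rewrite -[x i ^+ 2](sum_delta i (fun j => x i * x j)).
rewrite !mulr_sumr -sumrB; apply: eq_bigr => j _; rewrite /vhat_coef; ring.
Qed.

Section vhat_coef.
Variables (R : realType) (k : nat).
Hypothesis k2 : (2 <= k)%N.

Let k_gt0 : (0 < k)%N. Proof. exact: ltnW. Qed.
Let k0 : k%:R != 0 :> R. Proof. by rewrite pnatr_eq0 -lt0n. Qed.
Let k1 : k%:R - 1 != 0 :> R.
Proof. by rewrite subr_eq0 pnatr_eq1 gtn_eqF. Qed.
Let pk : k.-1%:R = k%:R - 1 :> R.
Proof. by rewrite -subn1 natrB. Qed.

Lemma vhat_coef_diag (i : 'I_k) : vhat_coef R i i = k%:R^-1.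
Proof. by rewrite /vhat_coef eqxx pk /=; field; rewrite k0 k1. Qed.

(** The squared Frobenius norm of an orthogonal projection is its rank, here [k - 1], and the
    prefactor contributes [(k - 1) ^- 2]. *)
Lemma sum_vhat_coef_sqr :
  \sum_i \sum_j (@vhat_coef R k i j) ^+ 2 = (k%:R - 1)^-1.
Proof.
transitivity (\sum_(i < k) (k%:R - 1)^-1 * k%:R^-1 : R); last first.
  by rewrite sum_cst_ord mulrCA divff ?mulr1.
apply: eq_bigr => i _.
(* Up to the prefactor, the diagonal square exceeds an off-diagonal one by
   [(1 - k^-1) ^+ 2 - k ^- 2 = 1 - 2 / k]. *)
transitivity (\sum_j ((i == j)%:R * ((k%:R - 1) ^- 2 * (1 - 2 / k%:R))
    + (k%:R - 1) ^- 2 * k%:R ^- 2) : R).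
  apply: eq_bigr => j _; rewrite /vhat_coef pk.
  by case: eqVneq => _ /=; field; rewrite k0 k1.
by rewrite big_split/= sum_delta sum_cst_ord; field; rewrite k0 k1.
Qed.

Variables (E : (('I_k -> R) -> R) -> R) (mu : nat -> R).
Hypotheses (Emu : iid_moments E mu) (mu0 : mu 0%N = 1) (mu1 : mu 1%N = 0).

Lemma moment_vhat : E (@vhat R k) = mu 2%N.
Proof.
have -> : @vhat R k = fun x => \sum_i \sum_j vhat_coef R i j * (x i * x j).
  by apply/funext => x; rewrite vhat_quadratic.
rewrite (moment_quadratic Emu)//.
under eq_bigr do rewrite vhat_coef_diag.
by rewrite sum_cst_ord divff ?mulr1.
Qed.

Lemma moment_vhat_sqr : E (fun x => vhat x ^+ 2) =
  mu 2%N ^+ 2 + 2 * mu 2%N ^+ 2 / (k%:R - 1)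
  + (mu 4%N - 3 * mu 2%N ^+ 2) / k%:R.
Proof.
transitivity (E (fun x => (\sum_i \sum_j vhat_coef R i j * (x i * x j)) ^+ 2)).
  by congr E; apply/funext => x; rewrite vhat_quadratic.
rewrite (moment_quadratic_sqr Emu)//; last first.
  by move=> i j; rewrite /vhat_coef eq_sym.
under eq_bigr do rewrite vhat_coef_diag.
under [X in _ + _ * X]eq_bigr do rewrite vhat_coef_diag.
by rewrite sum_vhat_coef_sqr !sum_cst_ord; field; rewrite k0 k1.
Qed.

End vhat_coef.

Lemma moment_linear (R : realType) (k : nat) (E : (('I_k -> R) -> R) -> R)
    (mu : nat -> R) (c : 'I_k -> R) :
  iid_moments E mu -> mu 0%N = 1 -> mu 1%N = 0 -> E (fun x => \sum_i c i * x i) = 0.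
Proof.
move=> Emu mu0 mu1; have := @Emu _ c (fun i => [:: i]) (fun=> isT).
under eq_fun => x do under eq_bigr do rewrite big_seq1.
move=> ->; apply: big1 => i _.
by rewrite prod_count_undup// big_seq1/= eqxx mu1 mulr0.
Qed.

Lemma prodr_count (R : comPzRingType) (I : finType) (s : seq I) (x : I -> R) :
  \prod_(i <- s) x i = \prod_i x i ^+ count_mem i s.
Proof.
elim: s => [|a s IH]; first by rewrite big_nil big1.
rewrite big_cons IH /= [in RHS](eq_bigr (fun i => x i ^+ (a == i) * x i ^+ count_mem i s)).
  rewrite big_split/= [X in _ = X * _](bigD1 a)//= eqxx expr1.
  by rewrite [X in _ * X * _]big1 ?mulr1// => i; rewrite eq_sym => /negbTE ->.
by move=> i _; rewrite exprD.
Qed.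

(** * Averages over a finite set and over functions into it *)

Definition mean (R : realType) (V : finType) (g : V -> R) : R :=
  #|V|%:R^-1 * \sum_v g v.

Section mean.
Variables (R : realType) (V : finType).
Hypothesis V0 : (0 < #|V|)%N.
Implicit Types g h : V -> R.

Lemma mean_cst c : mean (fun _ : V => c) = c :> R.
Proof. by rewrite /mean sumr_const -[X in _ * X]mulr_natl mulKf// pnatr_eq0 -lt0n. Qed.

Lemma meanD g h : mean (fun v => g v + h v) = mean g + mean h.
Proof. by rewrite /mean big_split mulrDr. Qed.

Lemma meanZ c g : mean (fun v => c * g v) = c * mean g.
Proof. by rewrite /mean -mulr_sumr mulrCA. Qed.

(** The exponent 1 is kept so that this is literally the hypothesis [mu 1 = 0] for the moments of
    the centred values. *)
Lemma mean_center g : mean (fun v => (g v - mean g) ^+ 1) = 0.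
Proof.
under eq_fun do rewrite expr1.
by rewrite meanD mean_cst subrr.
Qed.

Lemma mean_center_sqr g :
  mean (fun v => (g v - mean g) ^+ 2) = mean (fun v => g v ^+ 2) - mean g ^+ 2.
Proof.
set c := mean g.
under eq_fun => v.
  rewrite (_ : _ ^+ 2 = g v ^+ 2 + (- 2 * c * g v + c ^+ 2)); last by ring.
  over.
by rewrite !meanD meanZ mean_cst -/c; ring.
Qed.

(** A uniform function has independent uniform values: distributing a product of sums over all
    functions turns the average of a monomial into a product of averages. *)
Lemma iid_moments_ffun (k : nat) g :
  iid_moments (fun p => mean (fun f : {ffun 'I_k -> V} => p (fun j => g (f j))))
              (fun a => mean (fun v => g v ^+ a)).
Proof.
move=> I c s _; rewrite /mean exchange_big mulr_sumr; apply: eq_bigr => i _.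
rewrite -mulr_sumr mulrCA; congr (_ * _).
under eq_bigr do rewrite prodr_count.
rewrite -(bigA_distr_bigA (fun j v => g v ^+ count_mem j (s i))) /=.
rewrite big_split/= prodr_const card_ffun !card_ord natrX exprVn//.
Qed.

Lemma mean_expr0 g : mean (fun v => g v ^+ 0) = 1.
Proof. by under eq_fun do rewrite expr0; rewrite mean_cst. Qed.

End mean.

(** * First two moments of an average of independent uniform draws *)

Section bagging.
Variables (R : realType) (V : finType) (N : nat) (g : V -> R).
Hypothesis V0 : (0 < #|V|)%N.
Hypothesis N0 : (0 < N)%N.

Let bag (f : {ffun 'I_N -> V}) : R := N%:R^-1 * \sum_k g (f k).

(** Centring writes the average as a constant plus a linear form in centred i.i.d. values, to which
    the moments of linear forms apply. *)
Let bagE : bag = fun f => mean g + \sum_k N%:R^-1 * (g (f k) - mean g).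
Proof.
apply/funext => f; rewrite -mulr_sumr sumrB sum_cst_ord mulrBr mulrA.
by rewrite mulVf ?pnatr_eq0 -?lt0n// mul1r addrC subrK.
Qed.

Let ffun_gt0 : (0 < #|{ffun 'I_N -> V}|)%N.
Proof. by rewrite card_ffun expn_gt0 V0. Qed.

Let E (p : ('I_N -> R) -> R) :=
  mean (fun f : {ffun 'I_N -> V} => p (fun j => g (f j) - mean g)).

Let EE : iid_moments E (fun a => mean (fun v => (g v - mean g) ^+ a)).
Proof. exact: iid_moments_ffun. Qed.

Let centered_sum0 :
  mean (fun f : {ffun 'I_N -> V} => \sum_k N%:R^-1 * (g (f k) - mean g)) = 0.
Proof.
exact: (moment_linear (fun=> N%:R^-1) EE (mean_expr0 V0 _) (mean_center V0 _)).
Qed.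

Lemma mean_bagging : mean bag = mean g.
Proof. by rewrite bagE meanD// centered_sum0 addr0 mean_cst. Qed.

(** The cross term vanishes by centring, and the squared linear form contributes [N] terms of weight
    [N ^- 2]. *)
Lemma mean_bagging_sqr : mean (fun f => bag f ^+ 2) =
  mean g ^+ 2 + N%:R^-1 * mean (fun v => (g v - mean g) ^+ 2).
Proof.
pose l (f : {ffun 'I_N -> V}) := \sum_k N%:R^-1 * (g (f k) - mean g).
transitivity (mean (fun f => mean g ^+ 2 + (2 * mean g * l f + l f ^+ 2))).
  by congr mean; apply/funext => f; rewrite bagE -/(l f); ring.
rewrite meanD meanD meanZ mean_cst// centered_sum0 mulr0 add0r; congr (_ + _).
have := moment_linear2 EE (mean_expr0 V0 _) (mean_center V0 _) (fun=> N%:R^-1).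
rewrite /E => ->; rewrite sum_cst_ord mulrC; congr (_ * _).
rewrite expr2 mulrA mulfV ?mul1r//.
by rewrite pnatr_eq0 -lt0n.
Qed.

End bagging.

(** Lets the data be centred at the empirical mean, so that the first moment of a draw is zero. *)
Lemma vhat_shift (R : realType) (k : nat) (x : 'I_k -> R) (c : R) : (0 < k)%N ->
  vhat (fun j => x j - c) = vhat x.
Proof.
move=> k0; rewrite /vhat; congr (_ * _); apply: eq_bigr => i _; congr (_ ^+ 2).
by rewrite sumrB sum_cst_ord mulrBr mulKf ?pnatr_eq0 -?lt0n// opprB addrA addrNK.
Qed.

(** * Conditional mean and variance of the resampled variance, in empirical central moments *)

Section bootstrap.
Variables (R : realType) (n m : nat) (x : 'I_n -> R).
Hypotheses (n0 : (0 < n)%N) (m2 : (2 <= m)%N).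

Definition central_mean (a : nat) : R := mean (fun i => (x i - mean x) ^+ a).

Let n0' : (0 < #|'I_n|)%N. Proof. by rewrite card_ord. Qed.

Let E (p : ('I_m -> R) -> R) :=
  mean (fun f : {ffun 'I_m -> 'I_n} => p (fun j => x (f j) - mean x)).

Let EE : iid_moments E central_mean.
Proof. exact: iid_moments_ffun. Qed.

Let vhat_Lsub (u : {ffun 'I_m -> 'I_n}) :
  vhat (Lsub x u) = vhat (fun j => x (u j) - mean x).
Proof. by rewrite vhat_shift// ltnW. Qed.

Lemma EU_central : EU m x = central_mean 2.
Proof.
rewrite /EU -/(mean (fun u : {ffun 'I_m -> 'I_n} => vhat (Lsub x u))).
under eq_fun do rewrite vhat_Lsub.
exact: (moment_vhat m2 EE (mean_expr0 n0' _) (mean_center n0' _)).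
Qed.

Lemma VarU_central : VarU m x =
  2 * central_mean 2 ^+ 2 / (m%:R - 1)
  + (central_mean 4 - 3 * central_mean 2 ^+ 2) / m%:R.
Proof.
rewrite -[LHS]/(mean (fun u : {ffun 'I_m -> 'I_n} => (vhat (Lsub x u) - EU m x) ^+ 2)).
rewrite mean_center_sqr; last by rewrite card_ffun expn_gt0 n0'.
rewrite -[mean (fun u : {ffun 'I_m -> 'I_n} => vhat (Lsub x u))]/(EU m x) EU_central.
under eq_fun do rewrite vhat_Lsub.
have := moment_vhat_sqr m2 EE (mean_expr0 n0' _) (mean_center n0' _).
by rewrite /E => ->; ring.
Qed.

(** The second empirical central moment divides by [n] where [vhat] divides by [n - 1]. The moments
    of [EU] over the sample thus reduce to those of [vhat]. *)
Lemma EU_vhat : (2 <= n)%N -> EU m x = (n%:R - 1) / n%:R * vhat x.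
Proof.
move=> n2; rewrite EU_central /central_mean /mean /vhat card_ord -subn1 natrB//.
have : n%:R != 0 :> R by rewrite pnatr_eq0 -lt0n.
have : n%:R - 1 != 0 :> R by rewrite subr_eq0 pnatr_eq1 gtn_eqF.
by move=> ? ?; field; apply/andP.
Qed.

End bootstrap.

(** A centred observation is a linear form in the sample, so [moment_linear4] applies once the power
    sums of its coefficients are known. *)
Lemma moment_central4 (R : realType) (n : nat) (E : (('I_n -> R) -> R) -> R)
    (mu : nat -> R) (i : 'I_n) :
  iid_moments E mu -> mu 0%N = 1 -> mu 1%N = 0 ->
  E (fun x => (x i - mean x) ^+ 4) =
  3 * mu 2%N ^+ 2 * (1 - n%:R^-1) ^+ 2
  + (mu 4%N - 3 * mu 2%N ^+ 2) * ((1 - n%:R^-1) ^+ 4 + (n%:R - 1) / n%:R ^+ 4).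
Proof.
move=> EE mu0 mu1.
have nz : n%:R != 0 :> R by rewrite pnatr_eq0; case: n i {EE E} => // -[].
pose c (j : 'I_n) : R := (i == j)%:R - n%:R^-1.
(* The coefficient is [1 - n^-1] at [i] and [- n^-1] elsewhere; the sum is [n] equal terms plus a
   correction at [i]. *)
have sumc a : \sum_j c j ^+ a = (1 - n%:R^-1) ^+ a - (- n%:R^-1) ^+ a
    + n%:R * (- n%:R^-1) ^+ a.
  rewrite -sum_cst_ord.
  rewrite -[X in X + _](sum_delta i (fun=> (1 - n%:R^-1) ^+ a - (- n%:R^-1) ^+ a)).
  rewrite -big_split/=; apply: eq_bigr => j _; rewrite /c.
  by case: eqVneq => _ /=; rewrite ?mul1r ?subrK// mul0r !add0r.
transitivity (E (fun x => (\sum_j c j * x j) ^+ 4)).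
  congr E; apply/funext => x; congr (_ ^+ _); rewrite /mean card_ord.
  by under [RHS]eq_bigr do rewrite mulrBl; rewrite sumrB sum_delta mulr_sumr.
rewrite (moment_linear4 EE)// !sumc; congr (_ * _ ^+ 2 + _ * _); field => //.
Qed.

(** * Polynomials of bounded degree in the sample *)

Section poly_le.
Variables (R : realType) (n : nat).
Implicit Types p q : ('I_n -> R) -> R.

(** The same presentation as in [iid_moments]. Monomials are lists of indices over an arbitrary
    finite type, so that sums are disjoint unions and products are concatenations. *)
Definition poly_le (k : nat) p : Prop :=
  exists (I : finType) (c : I -> R) (s : I -> seq 'I_n),
    (forall i, (size (s i) <= k)%N) /\
    p = fun x => \sum_i c i * \prod_(j <- s i) x j.

Lemma poly_le_cst k c : poly_le k (fun=> c).
Proof.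
exists unit, (fun=> c), (fun=> [::]); split => //; apply/funext => x.
by rewrite big_const card_unit /= big_nil mulr1 addr0.
Qed.

Lemma poly_le_var i : poly_le 1 (fun x => x i).
Proof.
exists unit, (fun=> 1), (fun=> [:: i]); split => //; apply/funext => x.
by rewrite big_const card_unit /= big_seq1 mul1r addr0.
Qed.

Lemma poly_leW k l p : (k <= l)%N -> poly_le k p -> poly_le l p.
Proof.
move=> kl [I [c [s [sk ->]]]]; exists I, c, s; split => // i.
exact: leq_trans (sk i) kl.
Qed.

Lemma poly_leD k p q : poly_le k p -> poly_le k q -> poly_le k (fun x => p x + q x).
Proof.
move=> [I [c [s [sk ->]]]] [J [e [r [rk ->]]]].
exists (I + J)%type, (fun z => match z with inl i => c i | inr j => e j end),
  (fun z => match z with inl i => s i | inr j => r j end); split; first by case.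
by apply/funext => x; rewrite big_sumType.
Qed.

Lemma poly_leM k l p q : poly_le k p -> poly_le l q ->
  poly_le (k + l) (fun x => p x * q x).
Proof.
move=> [I [c [s [sk ->]]]] [J [e [r [rk ->]]]].
exists (I * J)%type, (fun z => c z.1 * e z.2), (fun z => s z.1 ++ r z.2).
split=> [z|]; first by rewrite size_cat leq_add.
apply/funext => x; rewrite big_distrlr pair_bigA/=; apply: eq_bigr => z _.
by rewrite big_cat/= mulrACA.
Qed.

Lemma poly_leZ k c p : poly_le k p -> poly_le k (fun x => c * p x).
Proof. exact: (poly_leM (poly_le_cst 0 c)). Qed.

Lemma poly_leB k p q : poly_le k p -> poly_le k q -> poly_le k (fun x => p x - q x).
Proof.
move=> hp /(poly_leZ (-1)) /(poly_leD hp); congr poly_le.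
by apply/funext => x; rewrite mulN1r.
Qed.

Lemma poly_leX k l p : poly_le k p -> poly_le (l * k) (fun x => p x ^+ l).
Proof.
move=> hp; elim: l => [|l IH]; first exact: poly_le_cst.
by have := poly_leM hp IH; congr poly_le; apply/funext => x; rewrite exprS.
Qed.

Lemma poly_le_sum k (I : Type) (s : seq I) (p : I -> ('I_n -> R) -> R) :
  (forall i, poly_le k (p i)) -> poly_le k (fun x => \sum_(i <- s) p i x).
Proof.
move=> hp; elim: s => [|i s IH].
  by have := poly_le_cst k 0; congr poly_le; apply/funext => x; rewrite big_nil.
have := poly_leD (hp i) IH; congr poly_le.
by apply/funext => x; rewrite big_cons.
Qed.

Lemma poly_le_mean k (V : finType) (p : V -> ('I_n -> R) -> R) :
  (forall v, poly_le k (p v)) -> poly_le k (fun x => mean (fun v => p v x)).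
Proof. by move=> hp; apply/poly_leZ/poly_le_sum. Qed.

Lemma poly_le_vhat : poly_le 2 (@vhat R n).
Proof.
apply/poly_leZ/poly_le_sum => i; apply: (poly_leX (k := 1) 2).
apply: poly_leB; first exact: poly_le_var.
by apply/poly_leZ/poly_le_sum => j; exact: poly_le_var.
Qed.

Lemma poly_le_vhat_Lsub m (u : {ffun 'I_m -> 'I_n}) :
  poly_le 2 (fun x => vhat (Lsub x u)).
Proof.
apply/poly_leZ/poly_le_sum => i; apply: (poly_leX (k := 1) 2).
apply: poly_leB; first exact: poly_le_var.
by apply/poly_leZ/poly_le_sum => j; exact: poly_le_var.
Qed.

Lemma poly_le_EU m : poly_le 2 (fun x => EU m x).
Proof. by apply: poly_le_mean => u; exact: poly_le_vhat_Lsub. Qed.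

Lemma poly_le_VarU m : poly_le 4 (fun x => VarU m x).
Proof.
apply: (poly_le_mean (p := fun u x => (vhat (Lsub x u) - EU m x) ^+ 2)) => u.
apply: (poly_leX (k := 2) 2); apply: poly_leB; last exact: poly_le_EU.
exact: poly_le_vhat_Lsub.
Qed.

End poly_le.

(** * Integrable variables with a prescribed real mean *)

(** Integrability travels with the value, so linearity carries no side conditions and means are
    computed in [R] instead of the extended reals. *)
Definition has_mean d (T : measurableType d) (R : realType) (P : probability T R)
    (f : T -> R) (v : R) : Prop :=
  P.-integrable setT (EFin \o f) /\ ('E_P[f] = v%:E)%E.

Section has_mean.
Context d (T : measurableType d) (R : realType) (P : probability T R).
Implicit Types (f g : T -> R) (v : R).

Lemma has_mean_eq f v v' : has_mean P f v -> v = v' -> has_mean P f v'.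
Proof. by move=> ? <-. Qed.

Lemma has_mean_ext f g v : f =1 g -> has_mean P f v -> has_mean P g v.
Proof. by move=> /funext ->. Qed.

Lemma has_mean_cst v : has_mean P (fun=> v) v.
Proof.
by split; [exact: finite_measure_integrable_cst | exact: expectation_cst].
Qed.

Lemma has_meanD f g v w : has_mean P f v -> has_mean P g w ->
  has_mean P (fun t => f t + g t) (v + w).
Proof.
move=> [fi fv] [gi gw]; split; first exact: (integrableD measurableT fi gi).
rewrite -[X in 'E_P[X]%E]/(f \+ g) expectationD ?fv ?gw//; exact/Lfun1_integrable.
Qed.

Lemma has_meanZ f v c : has_mean P f v -> has_mean P (fun t => c * f t) (c * v).
Proof.
move=> [fi fv]; split; first exact: (integrableZl measurableT c fi).
rewrite (_ : (fun t => _) = c \o* f); last by apply/funext => t /=; rewrite mulrC.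
by rewrite expectationZl ?fv//; exact/Lfun1_integrable.
Qed.

Lemma has_mean_sum I (s : seq I) (f : I -> T -> R) (v : I -> R) :
  (forall i, has_mean P (f i) (v i)) ->
  has_mean P (fun t => \sum_(i <- s) f i t) (\sum_(i <- s) v i).
Proof.
move=> fv; elim: s => [|i s IH].
  rewrite big_nil; apply: has_mean_ext (has_mean_cst 0) => t.
  by rewrite big_nil.
rewrite big_cons; apply: has_mean_ext (has_meanD (fv i) IH) => t.
by rewrite big_cons.
Qed.

Lemma has_mean_indic A : measurable A -> has_mean P \1_A (fine (P A)).
Proof.
move=> mA; split; first exact: integrable_indic.
by rewrite expectation_indic// fineK// fin_num_measure.
Qed.

Lemma has_mean_measurable f v : has_mean P f v -> measurable_fun setT f.
Proof. by move=> [/measurable_int /measurable_EFinP]. Qed.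

Lemma le_has_mean f g w : measurable_fun setT f -> (forall t, `|f t| <= `|g t|) ->
  has_mean P g w -> exists v, has_mean P f v.
Proof.
move=> mf fg [gi _].
have fi : P.-integrable setT (EFin \o f).
  apply: le_integrable gi => //; first exact/measurable_EFinP.
  by move=> t _; rewrite lee_fin.
exists (fine 'E_P[f]); split => //.
by rewrite fineK// expectation_fin_num//; exact/Lfun1_integrable.
Qed.

Lemma has_mean_cvg (f_ : nat -> T -> R) f g (v_ : nat -> R) v w :
  (forall n, has_mean P (f_ n) (v_ n)) -> has_mean P f v -> has_mean P g w ->
  (forall n t, `|f_ n t| <= `|g t|) ->
  (forall t, f_ n t @[n --> \oo] --> f t) ->
  v_ n @[n --> \oo] --> v.
Proof.
move=> fv fv' [gi _] fg ff; apply: (@fine_cvg _ _ _ _ (fun n => (v_ n)%:E)) => /=.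
have [|||||_ _] := @dominated_convergence _ _ _ P setT measurableT
  (fun n => EFin \o f_ n) (EFin \o f) (EFin \o (fun t => `|g t|)).
- by move=> n; apply/measurable_EFinP; exact: has_mean_measurable (fv n).
- by apply/measurable_EFinP; exact: has_mean_measurable fv'.
- by apply/aeW => t _; apply: cvg_EFin; [exact: nearW | exact: ff].
- exact: (integrable_norm gi).
- by apply/aeW => t n _; rewrite lee_fin.
rewrite -fv'.2 unlock; under [X in _ -> X @ _ --> _]eq_fun do rewrite -(fv _).2 unlock.
exact.
Qed.

Lemma fimfun_sum (rT : Type) (h : {fimfun rT >-> R}) r :
  h r = \sum_(y <- fset_set (range h)) y * \1_(h @^-1` [set y]) r.
Proof. by rewrite [LHS]fimfunE fsbig_finite. Qed.

Import HBNNSimple HBSimple.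

(* A weight [W] uncorrelated with every event [Z @^-1` A] is uncorrelated with
   every simple function of [Z], hence with [Z] by dominated convergence. *)
Lemma has_meanM_ge0 (W Z : T -> R) (h : R -> R) w v u :
  measurable_fun setT Z -> measurable_fun setT h -> (forall r, 0 <= h r) ->
  (forall A, measurable A ->
     has_mean P (fun t => W t * \1_(Z @^-1` A) t) (w * fine (P (Z @^-1` A)))) ->
  has_mean P W w -> has_mean P (h \o Z) v ->
  has_mean P (fun t => W t * h (Z t)) u -> u = w * v.
Proof.
move=> mZ mh h0 WZ Ww hv Whu.
have mh' : measurable_fun setT (EFin \o h) by exact/measurable_EFinP.
pose g n : R -> R := nnsfun_approx measurableT mh' n.
have gcvg r : g n r @[n --> \oo] --> h r.
  apply: (@fine_cvg _ _ _ _ (fun n => (g n r)%:E)).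
  by apply: (cvg_nnsfun_approx measurableT mh') => // x _; rewrite lee_fin.
have g0 n r : 0 <= g n r by exact: fun_ge0.
have gle n r : g n r <= h r.
  rewrite -(cvg_lim _ (gcvg r))//; apply: nondecreasing_cvgn_le.
    by move=> i j ij; apply/lefP; exact: nd_nnsfun_approx.
  by apply/cvg_ex; exists (h r).
(* Each approximation is a finite combination of indicators of events of [Z], so the product rule
   holds for it by linearity. *)
have mWg n : exists s, has_mean P (g n \o Z) s /\
    has_mean P (fun t => W t * g n (Z t)) (w * s).
  pose p y := fine (P (Z @^-1` (g n @^-1` [set y]))).
  exists (\sum_(y <- fset_set (range (g n))) y * p y).
  have mgy y : measurable (g n @^-1` [set y]) by exact: measurable_funPTI.
  split.
    apply: (has_mean_ext (f := fun t => \sum_(y <- fset_set (range (g n)))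
        y * \1_(Z @^-1` (g n @^-1` [set y])) t)).
      by move=> t /=; rewrite [RHS](fimfun_sum (nnsfun_approx measurableT mh' n)).
    apply: has_mean_sum => y; apply/has_meanZ/has_mean_indic.
    by rewrite -[X in measurable X]setTI; exact: mZ.
  apply: (has_mean_ext (f := fun t => \sum_(y <- fset_set (range (g n)))
      y * (W t * \1_(Z @^-1` (g n @^-1` [set y])) t))).
    move=> t; rewrite [g n _](fimfun_sum (nnsfun_approx measurableT mh' n)) mulr_sumr.
    by apply: eq_bigr => y _; rewrite mulrCA.
  rewrite mulr_sumr; under [X in has_mean _ _ X]eq_bigr do rewrite mulrCA.
  by apply: has_mean_sum => y; apply/has_meanZ/WZ.
have [s /all_and2 [gs Wgs]] := choice mWg.
(* The approximations lie below [h], so [h \o Z] and [W * (h \o Z)] are themselves the dominating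
   functions; uniqueness of the limit of [w * s n] concludes. *)
have lim1 : s n @[n --> \oo] --> v.
  apply: (has_mean_cvg gs hv hv) => [n t|t] /=; last exact: gcvg.
  by rewrite !ger0_norm.
have lim2 : w * s n @[n --> \oo] --> u.
  apply: (has_mean_cvg Wgs Whu Whu) => [n t|t] /=; last by apply: cvgMl_tmp; exact: gcvg.
  by rewrite !normrM ler_wpM2l// !ger0_norm.
by rewrite -(cvg_lim _ lim2)//; apply: cvg_lim => //; exact: cvgMl_tmp.
Qed.

(** [Z] is split into its positive and negative parts. Both are bounded by [Z] in absolute value, so
    they and their products with [W] inherit integrability. *)
Lemma has_meanM (W Z : T -> R) w v u :
  (forall A, measurable A ->
     has_mean P (fun t => W t * \1_(Z @^-1` A) t) (w * fine (P (Z @^-1` A)))) ->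
  has_mean P W w -> has_mean P Z v ->
  has_mean P (fun t => W t * Z t) u -> u = w * v.
Proof.
move=> WZ Ww Zv Wu; have mZ := has_mean_measurable Zv.
have mW := has_mean_measurable Ww.
have mpos : measurable_fun setT (fun r : R => Num.max r 0) by exact: measurable_maxr.
have mneg : measurable_fun setT (fun r : R => Num.max (- r) 0).
  by apply: measurable_maxr => //; exact: measurable_oppr.
have part (h : R -> R) : measurable_fun setT h -> (forall r, `|h r| <= `|r|) ->
    (forall r, 0 <= h r) -> exists s, has_mean P (h \o Z) s /\
    has_mean P (fun t => W t * h (Z t)) (w * s).
  move=> mh hle h0.
  have mhZ : measurable_fun setT (h \o Z) by exact: measurableT_comp.
  have [s hs] := le_has_mean mhZ (fun t => hle (Z t)) Zv.
  have [] := le_has_mean (f := fun t => W t * h (Z t)) _ _ Wu.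
  - exact: measurable_funM.
  - by move=> t; rewrite !normrM ler_wpM2l.
  move=> s' hs'; exists s; split => //.
  by rewrite -(has_meanM_ge0 mZ mh h0 WZ Ww hs hs').
have [|r|p [Zp Wp]] := part _ mpos.
- by move=> r; rewrite /Num.max; case: ifP => _; rewrite ?normr0.
- by rewrite le_max lexx orbT.
have [|r|q [Zq Wq]] := part _ mneg.
- by move=> r; rewrite /Num.max; case: ifP => _; rewrite ?normr0 ?normrN.
- by rewrite le_max lexx orbT.
have split_max r : r = Num.max r 0 + -1 * Num.max (- r) 0 :> R.
  by rewrite /Num.max oppr_lt0; case: ltgtP => [||->]; rewrite ?mulN1r ?oppr0 ?add0r ?addr0 ?opprK.
have vE : v = p + -1 * q.
  have := (has_meanD Zp (has_meanZ (-1) Zq)).2.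
  under eq_fun do rewrite -split_max.
  by move: Zv.2 => -> [].
have := (has_meanD Wp (has_meanZ (-1) Wq)).2.
under eq_fun do rewrite mulrCA -mulrDr -split_max.
by rewrite Wu.2 => -[->]; rewrite vE mulrCA mulrDr.
Qed.

End has_mean.

(** With [M] the maximum of 1 and all [|x i|], the product is at most [M ^+ 4], which is 1 or one of
    the [x i ^+ 4]. The bound is integrable as soon as fourth moments are finite. *)
Lemma prod_max_le (R : realType) (n : nat) (s : seq 'I_n) (x : 'I_n -> R) :
  (size s <= 4)%N ->
  \prod_(i <- s) Num.max 1 `|x i| <= 1 + \sum_i x i ^+ 4.
Proof.
move=> s4.
have [M [M1 xM M4]] : exists M : R, [/\ 1 <= M, (forall i, `|x i| <= M) &
    M ^+ 4 <= 1 + \sum_i x i ^+ 4].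
  (* Restricting to the indices of a list makes induction possible. *)
  suff [M [M1 xM M4]] : exists M : R, [/\ 1 <= M,
      (forall i, i \in index_enum 'I_n -> `|x i| <= M) &
      M ^+ 4 <= 1 + \sum_(i <- index_enum 'I_n) x i ^+ 4].
    by exists M; split => // i; apply: xM; rewrite mem_index_enum.
  elim: index_enum => [|i r [M [M1 xM M4]]].
    by exists 1; split => //; rewrite big_nil addr0 expr1n.
  have xi4 : `|x i| ^+ 4 = x i ^+ 4 by rewrite -normrX ger0_norm// exprn_even_ge0.
  have sum0 : 0 <= \sum_(j <- r) x j ^+ 4.
    by apply: sumr_ge0 => j _; rewrite exprn_even_ge0.
  have [xiM|Mxi] := leP `|x i| M.
    exists M; split => // [j|]; first by rewrite inE => /predU1P[->//|/xM].
    rewrite big_cons (le_trans M4)// lerD2l lerDr -xi4.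
    by rewrite exprn_ge0.
  exists `|x i|; split; first exact: le_trans (ltW Mxi).
    by move=> j; rewrite inE => /predU1P[->//|/xM /le_trans]; apply; exact: ltW.
  by rewrite big_cons xi4 addrCA lerDl addr_ge0.
apply: le_trans M4; apply: (@le_trans _ _ (M ^+ size s)); last first.
  exact: ler_weXn2l.
elim: s {s4} => [|i s IH]; first by rewrite big_nil.
rewrite big_cons exprS ler_pM//.
- by apply: prodr_ge0 => j _; rewrite le_max ler01.
- by rewrite ge_max M1 xM.
Qed.

(** * Expectations of polynomials in the sample, jointly with the bag *)

Section independent_sample.
Context d (T : measurableType d) (R : realType) (P : probability T R).
Variables (n N : nat) (V : finType).
Variables (X : {RV P >-> R}) (Xs : 'I_n -> {RV P >-> R}) (Us : 'I_N -> T -> V).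
Hypothesis X4 : (X : T -> R) \in Lfun P 4%:E.
Hypothesis X_Xs : forall i (A : set R), measurable A ->
  P (Xs i @^-1` A) = P (X @^-1` A).
Hypothesis indep : mutually_independent P (fun i => (Xs i : T -> R)) Us.

Definition raw_moment (a : nat) : R := fine 'E_P[fun w => X w ^+ a].

Let L w (i : 'I_n) : R := Xs i w.

Lemma integrable_exprX a : (a <= 4)%N ->
  P.-integrable setT (EFin \o (fun w => X w ^+ a)).
Proof.
move=> a4; have X4i : P.-integrable setT (EFin \o (fun w => X w ^+ 4)).
  have -> : EFin \o (fun w => X w ^+ 4) = (fun w => (`|X w| `^ 4)%:E).
    apply/funext => w /=; rewrite -[4]/(4%:R) powR_mulrn// -normrX ger0_norm//.
    by rewrite exprn_even_ge0.
  by apply: Lfun_integrable X4; rewrite ler1n.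
have := integrableD measurableT (finite_measure_integrable_cst P 1 measurableT) X4i.
apply: le_integrable => //.
  by apply/measurable_EFinP; exact: measurable_funX.
move=> w _; rewrite lee_fin.
(* One coordinate repeated [a] times gives the bound of [max(1, |X|) ^+ a] by [1 + X ^+ 4]. *)
have := @prod_max_le R 1 (nseq a ord0) (fun=> X w).
rewrite size_nseq big_nseq big_ord1 -Monoid.iteropE /= => /(_ a4) h.
rewrite (ger0_norm (addr_ge0 _ _))// ?exprn_even_ge0//; apply: le_trans h.
rewrite normrX -[iterop _ _ _ _]/(_ ^+ a) lerXn2r ?nnegrE//.
by rewrite le_max lexx orbT.
Qed.

Lemma has_mean_exprXs i a : (a <= 4)%N ->
  has_mean P (fun w => Xs i w ^+ a) (raw_moment a).
Proof.
move=> a4; have Xai := integrable_exprX a4.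
pose f (r : R) := (r ^+ a)%:E.
have mf : measurable_fun setT f.
  by apply/measurable_EFinP; exact: measurable_funX.
have eq_int g : (\int[distribution P (Xs i)]_y g y = \int[distribution P X]_y g y)%E.
  by apply: eq_measure_integral => A mA _; exact: X_Xs.
(* Integrability is transferred first, by the nonnegative change of variables applied to the
   absolute value of [f]; the signed integrals are compared afterwards. *)
have Xsai : P.-integrable setT (f \o Xs i).
  apply/integrableP; split; first exact: measurableT_comp.
  have /integrableP[_] := Xai; apply: le_lt_trans.
  have mnf : measurable_fun setT (abse \o f) by exact: measurableT_comp.
  have nf0 y : (0 <= (abse \o f) y)%E by exact: abse_ge0.
  rewrite -(ge0_integral_distribution (Xs i) mnf nf0).
  by rewrite eq_int ge0_integral_distribution.
split=> //; rewrite /raw_moment fineK; last first.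
  by rewrite expectation_fin_num//; exact/Lfun1_integrable.
rewrite unlock -[LHS]/(\int[P]_w (f \o Xs i) w)%E -[RHS]/(\int[P]_w (f \o X) w)%E.
by rewrite -!integral_distribution.
Qed.

Lemma has_mean_dominated (f : T -> R) (s : seq 'I_n) : (size s <= 4)%N ->
  measurable_fun setT f ->
  (forall w, `|f w| <= \prod_(i <- s) Num.max 1 `|Xs i w|) ->
  exists v, has_mean P f v.
Proof.
move=> s4 mf fs.
have [] := @le_has_mean _ _ _ P f (fun w => 1 + \sum_i Xs i w ^+ 4)
   (1 + \sum_(i < n) raw_moment 4) mf; last by move=> v; exists v.
- move=> w; rewrite (le_trans (fs w))//.
  apply: le_trans (ler_norm _); exact: prod_max_le.
- apply: has_meanD; first exact: has_mean_cst.
  by apply: has_mean_sum => i; exact: has_mean_exprXs.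
Qed.

Lemma prod_indic (I : finType) (A : I -> set R) (x : I -> T -> R) w :
  \prod_i \1_(A i) (x i w) =
  \1_(\bigcap_(i in [set: I]) (x i @^-1` A i)) w :> R.
Proof.
rewrite [RHS]indicE; have [wC|/negP wC] := boolP (w \in _).
  rewrite big1// => i _; rewrite indicE mem_set//.
  by move/set_mem : wC => /(_ i); exact.
have [i Ai] : exists i, x i w \notin A i.
  apply: contrapT => h; apply/wC/mem_set => i _.
  by apply/set_mem/negPn/negP => hi; apply: h; exists i.
by rewrite (bigD1 i)//= indicE (negbTE Ai) mul0r.
Qed.

Lemma prod_fineK (I : finType) (B : I -> set T) :
  (forall i, measurable (B i)) ->
  (\prod_i fine (P (B i)))%:E = (\prod_i P (B i))%E.
Proof.
move=> mB; rewrite -prodEFin; apply: eq_bigr => i _.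
by rewrite fineK// fin_num_measure.
Qed.

Lemma measurable_Xs i (A : set R) : measurable A -> measurable (Xs i @^-1` A).
Proof. by move=> mA; rewrite -[X in measurable X]setTI; exact: measurable_funP. Qed.

(* Independence is the case [r = [::]], where every factor is an indicator;
   the induction on [r] trades the indicators for powers one index at a time. *)
Lemma has_mean_hybrid (S : 'I_N -> set V) (s r : seq 'I_n) (A : 'I_n -> set R) :
  (forall k, measurable (Us k @^-1` S k)) ->
  (size s <= 4)%N -> uniq r -> (forall i, measurable (A i)) ->
  has_mean P
    (fun w => \prod_i (if i \in r then Xs i w ^+ count_mem i s
                       else \1_(A i) (Xs i w)) *
              \1_(\bigcap_(k in [set: 'I_N]) Us k @^-1` S k) w)
    (\prod_i (if i \in r then raw_moment (count_mem i s)
              else fine (P (Xs i @^-1` A i))) *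
     \prod_k fine (P (Us k @^-1` S k))).
Proof.
move=> mS s4; set B := \bigcap_(k in _) _.
have mB : measurable B by apply: fin_bigcap_measurable.
elim: r A => [|i0 r IH] A.
  move=> _ mA; pose C := (\bigcap_(i in [set: 'I_n]) (Xs i @^-1` A i)).
  have mC : measurable C.
    by apply: fin_bigcap_measurable => // i _; exact: measurable_Xs.
  have -> : (fun w => \prod_i (\1_(A i) (Xs i w)) * \1_B w) = \1_(C `&` B) :> (T -> R).
    by apply/funext => w; rewrite indicI /=; congr (_ * _); exact: (prod_indic A Xs).
  apply: has_mean_eq (has_mean_indic _ _) _; first exact: measurableI.
  rewrite indep// fineM; last 2 first.
  - by rewrite -prod_fineK// => i; exact: measurable_Xs.
  - by rewrite -prod_fineK.
  by rewrite -!prod_fineK//= => i; exact: measurable_Xs.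
move=> /= /andP[i0r ur] mA.
pose a := count_mem i0 s.
pose W (w : T) := \prod_(i | i != i0)
  (if i \in r then Xs i w ^+ count_mem i s else \1_(A i) (Xs i w)) * \1_B w.
pose m := \prod_(i | i != i0) (if i \in r then raw_moment (count_mem i s)
              else fine (P (Xs i @^-1` A i))) *
     \prod_k fine (P (Us k @^-1` S k)).
(* The induction hypothesis with [A i0] replaced by [A']: the remaining factors [W] are uncorrelated
   with every event of [Xs i0]. *)
have GW A' : measurable A' -> has_mean P (fun w => W w * \1_(Xs i0 @^-1` A') w)
   (m * fine (P (Xs i0 @^-1` A'))).
  move=> mA'; have mA'' i : measurable (if i == i0 then A' else A i).
    by case: ifP.
  have := IH _ ur mA''; congr has_mean.
    apply/funext => w; rewrite (bigD1 i0)//= (negbTE i0r) eqxx -mulrA mulrC.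
    congr (_ * _ * _).
    by apply: eq_bigr => i /negbTE ->.
  rewrite (bigD1 i0)//= (negbTE i0r) eqxx -mulrA mulrC; congr (_ * _ * _).
  by apply: eq_bigr => i /negbTE ->.
have Wm : has_mean P W m.
  have := GW _ measurableT; congr has_mean; last first.
    by rewrite preimage_setT probability_setT mulr1.
  by apply/funext => w; rewrite preimage_setT indicT mulr1.
have Za : has_mean P (fun w => Xs i0 w ^+ a) (raw_moment a).
  apply: has_mean_exprXs; exact: leq_trans (count_size _ _) s4.
(* Integrability by domination: powers are bounded by powers of [max(1, |Xs i|)], and indicators by
   1. *)
have [u Wu] : exists u, has_mean P (fun w => W w * Xs i0 w ^+ a) u.
  apply: (has_mean_dominated s4).
    exact: measurable_funM (has_mean_measurable Wm) (has_mean_measurable Za).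
  move=> w; rewrite prodr_count (bigD1 i0)//= [leRHS]mulrC !normrM normrX.
  apply: ler_pM => //; last first.
    by rewrite lerXn2r ?nnegrE// ?le_max ?lexx ?ler01 ?orbT.
  rewrite -[leRHS]mulr1 ler_pM//; last first.
    by rewrite indicE; case: (_ \in _); rewrite ?normr1 ?normr0.
  rewrite normr_prod; apply: ler_prod => i _; rewrite normr_ge0/=.
  case: ifP => _.
    by rewrite normrX lerXn2r ?nnegrE// ?le_max ?lexx ?ler01 ?orbT.
  have : 1 <= Num.max 1 `|Xs i w| ^+ count_mem i s.
    by rewrite exprn_ege1// le_max lexx.
  by apply: le_trans; rewrite indicE; case: (_ \in _); rewrite ?normr1 ?normr0.
have uE : u = m * raw_moment a.
  apply: (has_meanM _ Wm Za Wu) => A' mA'.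
  (* An event of the power [Xs i0 ^+ a] is an event of [Xs i0], through the preimage under
     [r ^+ a]. *)
  rewrite -[_ @^-1` A']/(Xs i0 @^-1` ((fun r : R => r ^+ a) @^-1` A')).
  apply: GW; rewrite -[X in measurable X]setTI.
  by have /(_ measurableT _ mA') := @measurable_funX _ _ _ _ _ a (@measurable_id _ R setT).
have := Wu; rewrite uE; congr has_mean.
  apply/funext => w; rewrite [in RHS](bigD1 i0)//= inE eqxx mulrC -mulrA.
  congr (_ * (_ * _)); apply: eq_bigr => i /negbTE ii0.
  by rewrite inE ii0.
rewrite [in RHS](bigD1 i0)//= inE eqxx mulrC -mulrA.
congr (_ * (_ * _)); apply: eq_bigr => i /negbTE ii0.
by rewrite inE ii0.
Qed.

Definition poly_mean (p : ('I_n -> R) -> R) : R := fine 'E_P[fun w => p (L w)].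

(** The hybrid product with every index exchanged for a power: only the bag event remains as an
    indicator, and its probability factors out. *)
Lemma has_mean_poly_indic (S : 'I_N -> set V) (I : finType) (c : I -> R)
    (s : I -> seq 'I_n) :
  (forall k, measurable (Us k @^-1` S k)) -> (forall i, (size (s i) <= 4)%N) ->
  has_mean P
    (fun w => (\sum_i c i * \prod_(j <- s i) L w j) *
              \1_(\bigcap_(k in [set: 'I_N]) Us k @^-1` S k) w)
    ((\sum_i c i * \prod_j raw_moment (count_mem j (s i))) *
     \prod_k fine (P (Us k @^-1` S k))).
Proof.
move=> mS s4; rewrite mulr_suml; under eq_fun do rewrite mulr_suml.
apply: has_mean_sum => i; rewrite -mulrA; under eq_fun do rewrite -mulrA.
apply: has_meanZ.
have := has_mean_hybrid mS (s4 i) (enum_uniq 'I_n) (fun=> measurableT).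
under eq_fun => w do under eq_bigr do rewrite mem_enum /=.
under [X in has_mean _ _ (X * _)]eq_bigr do rewrite mem_enum /=.
by under eq_fun do rewrite -prodr_count.
Qed.

Lemma has_mean_sum_monomial (I : finType) (c : I -> R) (s : I -> seq 'I_n) :
  (forall i, (size (s i) <= 4)%N) ->
  has_mean P (fun w => \sum_i c i * \prod_(j <- s i) L w j)
    (\sum_i c i * \prod_j raw_moment (count_mem j (s i))).
Proof.
move=> s4; have mS k : measurable (Us k @^-1` setT) by rewrite preimage_setT.
have := has_mean_poly_indic c mS s4; congr has_mean.
  by apply/funext => w; rewrite indicE mem_set ?mulr1.
rewrite [X in _ * X]big1 ?mulr1// => k _.
by rewrite preimage_setT probability_setT.
Qed.

Lemma poly_meanE p v : has_mean P (fun w => p (L w)) v -> poly_mean p = v.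
Proof. by move=> [_]; rewrite /poly_mean => ->. Qed.

Lemma has_mean_poly p : poly_le 4 p -> has_mean P (fun w => p (L w)) (poly_mean p).
Proof.
move=> [I [c [s [s4 ->]]]]; have h := has_mean_sum_monomial c s4.
by rewrite (poly_meanE h).
Qed.

Lemma iid_moments_poly_mean : iid_moments poly_mean raw_moment.
Proof. by move=> I c s s4; apply: poly_meanE; exact: has_mean_sum_monomial. Qed.

Lemma poly_meanD p q : poly_le 4 p -> poly_le 4 q ->
  poly_mean (fun x => p x + q x) = poly_mean p + poly_mean q.
Proof.
by move=> hp hq; apply: poly_meanE; apply: has_meanD; exact: has_mean_poly.
Qed.

Lemma poly_meanZ c p : poly_le 4 p -> poly_mean (fun x => c * p x) = c * poly_mean p.
Proof. by move=> hp; apply: poly_meanE; apply: has_meanZ; exact: has_mean_poly. Qed.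

Lemma poly_mean_mean (I : finType) (p : I -> ('I_n -> R) -> R) :
  (forall i, poly_le 4 (p i)) ->
  poly_mean (fun x => mean (fun i => p i x)) = mean (fun i => poly_mean (p i)).
Proof.
move=> hp; apply: poly_meanE; apply: has_meanZ; apply: has_mean_sum => i.
exact: has_mean_poly.
Qed.

Hypothesis mUs : forall k u, measurable (Us k @^-1` [set u]).
Hypothesis PUs : forall k u, P (Us k @^-1` [set u]) = (#|V|%:R^-1)%:E.

(** The space is partitioned by the value [f] of the bag. On each piece the integrand is the fixed
    polynomial [F f], and each piece has the same probability, the inverse of the number of bags;
    summing gives the average over bags. *)
Lemma has_mean_random_poly (F : {ffun 'I_N -> V} -> ('I_n -> R) -> R) :
  (forall f, poly_le 4 (F f)) ->
  has_mean P (fun w => F [ffun k => Us k w] (L w))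
    (poly_mean (fun x => mean (fun f => F f x))).
Proof.
move=> F4; rewrite poly_mean_mean// /mean mulr_sumr.
apply: (has_mean_ext (f := fun w => \sum_(f : {ffun 'I_N -> V}) F f (L w) *
    \1_(\bigcap_(k in [set: 'I_N]) Us k @^-1` [set f k]) w)).
  move=> w; rewrite (bigD1 [ffun k => Us k w])//= big1 ?addr0.
    by rewrite indicE mem_set ?mulr1// => k _ /=; rewrite ffunE.
  move=> f fU; rewrite indicE memNset ?mulr0// => h.
  move/eqP : fU; apply; apply/ffunP => k; rewrite ffunE.
  by rewrite -(h k I).
apply: has_mean_sum => f; have [I [c [s [s4 FE]]]] := F4 f.
have := has_mean_poly_indic c (fun k => mUs k (f k)) s4; congr has_mean.
  by apply/funext => w; rewrite FE.
rewrite mulrC FE iid_moments_poly_mean//; congr (_ * _).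
under eq_bigr do rewrite PUs /=.
by rewrite prodr_const card_ffun !card_ord natrX exprVn.
Qed.

End independent_sample.

(** * Variance and mean squared error of the bagged estimator *)

Lemma has_mean_sqrB d (T : measurableType d) (R : realType)
    (P : probability T R) (f : T -> R) (v s c : R) :
  has_mean P f v -> has_mean P (fun w => f w ^+ 2) s ->
  has_mean P (fun w => (f w - c) ^+ 2) (s + (- 2 * c * v + c ^+ 2)).
Proof.
move=> fv fs.
have := has_meanD fs (has_meanD (has_meanZ (- 2 * c) fv) (has_mean_cst P (c ^+ 2))).
by congr has_mean; apply/funext => w; ring.
Qed.

Lemma variance_has_mean d (T : measurableType d) (R : realType)
    (P : probability T R) (f : T -> R) (v s : R) :
  has_mean P f v -> has_mean P (fun w => f w ^+ 2) s ->
  ('V_P[f] = (s - v ^+ 2)%:E)%E.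
Proof.
move=> fv fs; rewrite /variance unlock fv.2 /=.
have /has_mean_eq -/(_ (s - v ^+ 2)) := has_mean_sqrB v fv fs.
by move=> [|_ <-]; first ring.
Qed.

Theorem theorem2 (d : measure_display) (T : measurableType d) (R : realType)
  (P : probability T R) (n m N : nat)
  (X : {RV P >-> R}) (Xs : 'I_n -> {RV P >-> R})
  (Us : 'I_N -> T -> {ffun 'I_m -> 'I_n}) :
  (2 <= n)%N -> (2 <= m)%N -> (1 <= N)%N ->
  (X : T -> R) \in Lfun P 4%:E ->
  ('E_P[X] = 0)%E ->
  (forall i (A : set R), measurable A ->
     P (Xs i @^-1` A) = P (X @^-1` A)) ->
  (forall k u, measurable (Us k @^-1` [set u])) ->
  (forall k u, P (Us k @^-1` [set u]) =
     ((#|{ffun 'I_m -> 'I_n}|%:R)^-1)%:E) ->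
  mutually_independent P (fun i => (Xs i : T -> R)) Us ->
  let mu2 := fine ('E_P[fun w => (X w ^+ 2)%R])%E in
  let mu4 := fine ('E_P[fun w => (X w ^+ 4)%R])%E in
  let vt := vtilde (fun i => (Xs i : T -> R)) Us in
  let L := fun w (i : 'I_n) => Xs i w in
  ([/\ 'E_P[vt] = ((n%:R - 1) / n%:R * mu2)%R%:E,
      'V_P[vt] = ((N%:R^-1)%R%:E * 'E_P[fun w => VarU m (L w)]
                  + 'V_P[fun w => EU m (L w)])%E,
      'E_P[fun w => VarU m (L w)] =
        ((n%:R - 1) / (n%:R * m%:R * (m%:R - 1)) *
           (3 * m%:R - 3 + (n%:R ^+ 2 - 2 * n%:R + 3) / n%:R ^+ 2
                             * (6 - 4 * m%:R)) * mu2 ^+ 2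
         + (n%:R - 1) / (n%:R * m%:R * (m%:R - 1)) *
           (m%:R - 1 + (n%:R - 1) / n%:R ^+ 2 * (6 - 4 * m%:R)) * mu4)%R%:E,
      'V_P[fun w => EU m (L w)] =
        ((3 - n%:R) * (n%:R - 1) / n%:R ^+ 3 * mu2 ^+ 2
         + (n%:R - 1) ^+ 2 / n%:R ^+ 3 * mu4)%R%:E
    & 'E_P[fun w => ((vt w - mu2) ^+ 2)%R] =
        ('V_P[vt] + ((n%:R ^+ 2)^-1)%R%:E * (mu2 ^+ 2)%R%:E)])%E.
Proof.
move=> n2 m2 N1 X4 EX0 X_Xs mUs PUs indep mu2 mu4 vt L.
pose mu := raw_moment X; pose E := poly_mean Xs.
have n0 : (0 < n)%N by exact: ltnW.
have nz : n%:R != 0 :> R by rewrite pnatr_eq0 -lt0n.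
have n1z : n%:R - 1 != 0 :> R by rewrite subr_eq0 pnatr_eq1 gtn_eqF.
have mz : m%:R != 0 :> R by rewrite pnatr_eq0 -lt0n ltnW.
have m1z : m%:R - 1 != 0 :> R by rewrite subr_eq0 pnatr_eq1 gtn_eqF.
have Nz : N%:R != 0 :> R by rewrite pnatr_eq0 -lt0n.
have V0 : (0 < #|{ffun 'I_m -> 'I_n}|)%N by rewrite card_ffun expn_gt0 card_ord n0.
have mu0 : mu 0%N = 1.
  rewrite /mu /raw_moment; under eq_fun do rewrite expr0.
  by rewrite (has_mean_cst P 1).2.
have mu1 : mu 1%N = 0 by rewrite /mu /raw_moment EX0.
have EE : iid_moments E mu := iid_moments_poly_mean X4 X_Xs indep.
have hE p : poly_le 4 p -> has_mean P (fun w => p (L w)) (E p).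
  exact: (has_mean_poly X4 X_Xs indep).
have EZ c p : poly_le 4 p -> E (fun x => c * p x) = c * E p.
  exact: (poly_meanZ X4 X_Xs indep).
have ED p q : poly_le 4 p -> poly_le 4 q -> E (fun x => p x + q x) = E p + E q.
  exact: (poly_meanD X4 X_Xs indep).
have EU4 : poly_le 4 (fun x : 'I_n -> R => EU m x).
  exact: poly_leW (poly_le_EU _ _ _).
have EUsqr4 : poly_le 4 (fun x : 'I_n -> R => EU m x ^+ 2).
  exact: (poly_leX 2 (poly_le_EU _ _ _)).
have VarU4 := @poly_le_VarU R n m.
(* The estimator with the bag frozen at [f]: its degree is at most 2 in the sample, so its square
   stays within degree 4. *)
pose F (f : {ffun 'I_N -> {ffun 'I_m -> 'I_n}}) (x : 'I_n -> R) :=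
  N%:R^-1 * \sum_k vhat (Lsub x (f k)).
have vtF : vt = fun w => F [ffun k => Us k w] (L w).
  apply/funext => w; rewrite /vt /vtilde /F; congr (_ * _).
  by apply: eq_bigr => k _; rewrite ffunE.
have F2 f : poly_le 2 (F f).
  by apply/poly_leZ/poly_le_sum => k; exact: poly_le_vhat_Lsub.
have F4 f : poly_le 4 (F f) by exact: poly_leW (F2 f).
have hvt : has_mean P vt (E (EU m)).
  have := has_mean_random_poly X4 X_Xs indep mUs PUs F4.
  rewrite -vtF; congr has_mean; congr E; apply/funext => x.
  exact: mean_bagging.
have hvt2 : has_mean P (fun w => vt w ^+ 2)
    (E (fun x => EU m x ^+ 2) + N%:R^-1 * E (VarU m)).
  have := has_mean_random_poly (F := fun f x => F f x ^+ 2)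
    X4 X_Xs indep mUs PUs (fun f => poly_leX 2 (F2 f)).
  rewrite vtF; congr has_mean; rewrite -EZ// -ED//; last exact: poly_leZ.
  congr E; apply/funext => x.
  exact: mean_bagging_sqr.
pose c : R := (n%:R - 1) / n%:R.
have vhat2 : poly_le 2 (@vhat R n) by exact: poly_le_vhat.
have EUvhat : EU m = fun x : 'I_n -> R => c * vhat x.
  by apply/funext => x; exact: EU_vhat.
have EEU : E (EU m) = c * mu2.
  by rewrite EUvhat EZ ?(moment_vhat n2 EE)//; exact: poly_leW vhat2.
(* The second moment of [vhat] over a sample of size [n]. *)
pose s : R := mu2 ^+ 2 + 2 * mu2 ^+ 2 / (n%:R - 1) + (mu4 - 3 * mu2 ^+ 2) / n%:R.
have EEUsqr : E (fun x => EU m x ^+ 2) = c ^+ 2 * s.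
  rewrite EUvhat; under eq_fun do rewrite exprMn.
  rewrite EZ; last exact: (poly_leX 2 vhat2).
  by rewrite (moment_vhat_sqr n2 EE).
(* The expected fourth empirical central moment; every index contributes the same value. *)
pose M4 : R := 3 * mu2 ^+ 2 * (1 - n%:R^-1) ^+ 2
  + (mu4 - 3 * mu2 ^+ 2) * ((1 - n%:R^-1) ^+ 4 + (n%:R - 1) / n%:R ^+ 4).
have central4 (i : 'I_n) : poly_le 4 (fun x : 'I_n -> R => (x i - mean x) ^+ 4).
  apply: (poly_leX (k := 1) 4); apply: poly_leB; first exact: poly_le_var.
  by apply: poly_le_mean => j; exact: poly_le_var.
have central_mean4 : poly_le 4 (fun x : 'I_n -> R => central_mean x 4).
  exact: poly_le_mean.
have EM4 : E (fun x => central_mean x 4) = M4.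
  transitivity (mean (fun i => E (fun x => (x i - mean x) ^+ 4))).
    exact: (poly_mean_mean X4 X_Xs indep).
  under eq_fun do rewrite (moment_central4 _ EE)//.
  by rewrite mean_cst// card_ord.
(* [VarU_central] regrouped as a linear combination of [EU m x ^+ 2] and [central_mean x 4], whose
   expectations are known. *)
have EVarU : E (VarU m) = 2 / (m%:R - 1) * (c ^+ 2 * s)
    + m%:R^-1 * (M4 + - 3 * (c ^+ 2 * s)).
  rewrite -EEUsqr -EM4 -!EZ// -ED//; last exact: poly_leZ.
  rewrite -EZ; last by apply: poly_leD => //; exact: poly_leZ.
  rewrite -ED; last 2 first.
  - exact: poly_leZ.
  - by apply/poly_leZ/poly_leD => //; exact: poly_leZ.
  congr E; apply/funext => x.
  by rewrite VarU_central// EU_central//; ring.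
have VarvT := variance_has_mean hvt hvt2.
have VarEU := variance_has_mean (hE _ EU4) (hE _ EUsqr4).
split.
- by rewrite hvt.2 EEU.
(* Both variances subtract the same [E (EU m) ^+ 2], so they differ by [N^-1 * E (VarU m)]. *)
- rewrite VarvT VarEU (hE _ VarU4).2 -EFinM -EFinD; congr EFin.
  rewrite -/(E _); ring.
- by rewrite (hE _ VarU4).2 EVarU /M4 /s /c; congr EFin; field; rewrite nz n1z mz m1z.
- by rewrite VarEU EEU EEUsqr /s /c; congr EFin; field; rewrite nz n1z.
(* The bias [c * mu2 - mu2] equals [- mu2 / n], whose square is the additional term. *)
- rewrite (has_mean_sqrB mu2 hvt hvt2).2 VarvT -EFinM -EFinD EEU /c; congr EFin.
  by field; rewrite nz Nz.
Qed.
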